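(* Let $(\mathcal{X},\Gamma,\xi)$ be a voltage $(r+1)$-premaniplex and suppose $\xi(d)=1$ for every dart $d$ of color smaller than $r$. Then $\mathcal{X}^\xi$ is a polytope if and only if the connected components of $\mathcal{X}_{\overline{r}}$ are polytopes and, for every $m\in[0,r]$, whenever there is a path $W$ in $\mathcal{X}$ with voltage $1$ using only colors in $[m,r]$ and ending in the same connected component of $\mathcal{X}_{\overline{r}}$ in which it started, there is also a path $W'$ in $\mathcal{X}$ with the same endpoints as $W$ that uses only colors in $[m,r-1]$.
   Context: Graphs may have semi-edges and parallel edges: a graph has vertices, darts, an initial-vertex map $I$ and an involution $d\mapsto d^{-1}$; $T(d)=I(d^{-1})$; a semi-edge is a dart with $d=d^{-1}$; darts are parallel if they share initial and final vertices. A path is a sequence of darts $d_1\cdots d_\ell$ with $T(d_i)=I(d_{i+1})$. An $n$-premaniplex is a connected graph with edges colored by $\{0,\dots,n-1\}$, each vertex (flag) incident to exactly one edge of each color, and alternating paths of length 4 in colors $i,j$ closed for $|i-j|>1$; an $n$-maniplex is a simple $n$-premaniplex. $\mathcal{X}_{\overline{r}}$ is $\mathcal{X}$ with its color-$r$ edges removed. An abstract polytope is a maniplex of rank $n$ such that whenever two flags are joined by a path with colors in $[0,m]$ and by a path with colors in $[k,n-1]$, they are joined by a path with colors in $[k,m]$. A voltage assignment with group $\Gamma$ is a map $\xi$ on darts with $\xi(d^{-1})=\xi(d)^{-1}$; the voltage of a path $W=d_1\cdots d_\ell$ is $\xi(W)=\xi(d_\ell)\cdots\xi(d_1)$. A voltage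 premaniplex $(\mathcal{X},\Gamma,\xi)$ is a premaniplex $\mathcal{X}$ with such a $\xi$ such that: $\Gamma$ is generated by the voltages of the darts outside some spanning tree $T$ of $\mathcal{X}$ all of whose darts have trivial voltage; every semi-edge has voltage of order 2; parallel darts have distinct voltages; and for $|i-j|>1$ every alternating path of length 4 in colors $i,j$ has trivial voltage. The derived graph $\mathcal{X}^\xi$ has vertex set $V(\mathcal{X})\times\Gamma$ and darts $(d,\gamma)$ from $(I(d),\gamma)$ to $(T(d),\xi(d)\gamma)$ with $(d,\gamma)^{-1}=(d^{-1},\xi(d)\gamma)$, colors inherited; it is a maniplex. *)

(* Defs.v *)
From Stdlib Require List.
From mathcomp Require Import all_boot.
From mathcomp Require Import boolp.

Set Implicit Arguments.
Unset Strict Implicit.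
Unset Printing Implicit Defensive.

Local Open Scope group_scope.

(* Graphs given by darts, with possibly infinitely many vertices. An edge is
   {d, dinv d}; d is a semi-edge when dinv d = d. *)
Record cgraph := CGraph {
  vertex : Type;
  dart : Type;
  init : dart -> vertex;
  dinv : dart -> dart;
  colour : dart -> nat;
  dinvK : involutive dinv;
  colour_dinv : forall d, colour (dinv d) = colour d }.

Section Graphs.
Variable G : cgraph.
Implicit Types (d e : dart G) (x y : vertex G) (p : seq (dart G)).

Definition term d : vertex G := init (dinv d).

Definition semi_edge d : Prop := dinv d = d.

Definition parallel d e : Prop := init d = init e /\ term d = term e.

(* The empty path is a path from each vertex to itself. *)
Fixpoint is_path x p y : Prop :=
  if p is d :: q then init d = x /\ is_path (term d) q y else x = y.

Definition uses_colours (C : pred nat) p : bool := all (fun d => C (colour d)) p.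

Definition joined x y : Prop := exists p, is_path x p y.

Definition joined_using (C : pred nat) x y : Prop :=
  exists p, is_path x p y /\ uses_colours C p.

Definition connected : Prop := inhabited (vertex G) /\ forall x y, joined x y.

(* A semi-edge is a cycle of length 1, and a pair of distinct parallel edges
   gives a cycle of length 2; going back and forth along an edge does not. *)
Definition is_cycle p : Prop :=
  [/\ p <> [::], exists x, is_path x p x, List.NoDup (map (@init G) p)
    & List.ForallOrdPairs (fun d e => e <> dinv d) p].

Definition tree : Prop := connected /\ forall p, ~ is_cycle p.

Definition alternating_path (i j : nat) x p y : Prop :=
  is_path x p y /\ map (@colour G) p = [:: i; j; i; j].

End Graphs.

Section SpanningSubgraph.
Variables (G : cgraph) (T : pred (dart G)) (Tinv : forall d, T d -> T (dinv d)).

Definition spanning_dinv (d : {d | T d}) : {d | T d} :=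
  exist _ (dinv (val d)) (Tinv (valP d)).

Lemma spanning_dinvK : involutive spanning_dinv.
Proof. by move=> d; apply: val_inj => /=; rewrite dinvK. Qed.

Definition spanning_subgraph : cgraph :=
  {| vertex := vertex G;
     dart := {d | T d};
     init := fun d => init (val d);
     dinv := spanning_dinv;
     colour := fun d => colour (val d);
     dinvK := spanning_dinvK;
     colour_dinv := fun d => colour_dinv (val d) |}.

End SpanningSubgraph.

Definition spanning_tree (G : cgraph) (T : pred (dart G)) : Prop :=
  exists Tinv : forall d, T d -> T (dinv d), tree (spanning_subgraph Tinv).

Lemma colour_neq_dinv (G : cgraph) (r : nat) (d : dart G) :
  colour d != r -> colour (dinv d) != r.
Proof. by rewrite colour_dinv. Qed.

Definition remove_colour (r : nat) (G : cgraph) : cgraph :=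
  @spanning_subgraph G (fun d => colour d != r) (@colour_neq_dinv G r).

Section Component.
Variables (G : cgraph) (x0 : vertex G).

Definition cvertex := {x : vertex G | `[< joined x0 x >]}.
Definition cdart := {d : dart G | `[< joined x0 (init d) >]}.

Lemma joined_term (d : dart G) : joined x0 (init d) -> joined x0 (term d).
Proof.
case=> p; elim: p x0 => [|e p IHp] x /=; first by move=> ->; exists [:: d].
by case=> <- /IHp[q pq]; exists (e :: q).
Qed.

Definition component_init (d : cdart) : cvertex := exist _ (init (val d)) (valP d).

Definition component_dinv (d : cdart) : cdart :=
  exist _ (dinv (val d)) (asboolT (joined_term (asboolW (valP d)))).

Lemma component_dinvK : involutive component_dinv.
Proof. by move=> d; apply: val_inj => /=; rewrite dinvK. Qed.

Definition component : cgraph :=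
  {| vertex := cvertex;
     dart := cdart;
     init := component_init;
     dinv := component_dinv;
     colour := fun d => colour (val d);
     dinvK := component_dinvK;
     colour_dinv := fun d => colour_dinv (val d) |}.

End Component.

(* The second clause counts darts, so the unique edge of a given colour at a
   vertex is either a semi-edge or joins two distinct vertices; a loop would
   contribute two darts of the same colour. *)
Definition premaniplex (n : nat) (X : cgraph) : Prop :=
  [/\ connected X,
      forall d : dart X, colour d < n,
      forall (x : vertex X) (i : nat), i < n ->
        exists! d : dart X, init d = x /\ colour d = i
    & forall (i j : nat) (x y : vertex X) (p : seq (dart X)),
        (i.+1 < j) || (j.+1 < i) -> alternating_path i j x p y -> x = y].

Definition simple (X : cgraph) : Prop :=
  (forall d : dart X, init d <> term d) /\
  (forall d e : dart X, parallel d e -> d = e).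

Definition maniplex (n : nat) (M : cgraph) : Prop := premaniplex n M /\ simple M.

(* When m < k the interval [k, m] is empty and the conclusion reads x = y. *)
Definition polytope (n : nat) (M : cgraph) : Prop :=
  maniplex n M /\
  forall (k m : nat) (x y : vertex M), k < n -> m < n ->
    joined_using (fun c => c <= m) x y ->
    joined_using (fun c => k <= c < n) x y ->
    joined_using (fun c => k <= c <= m) x y.

(* S generates Gam: the only subgroup containing S is Gam itself. *)
Definition generates (Gam : groupType) (S : Gam -> Prop) : Prop :=
  forall H : Gam -> Prop,
    H 1 -> (forall g h, H g -> H h -> H (g * h)) -> (forall g, H g -> H g^-1) ->
    (forall g, S g -> H g) -> forall g, H g.

Record voltage (X : cgraph) (Gam : groupType) := Voltage {
  volt :> dart X -> Gam;
  volt_dinv : forall d, volt (dinv d) = (volt d)^-1 }.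

Section Voltage.
Variables (X : cgraph) (Gam : groupType) (xi : voltage X Gam).

(* path_voltage [:: d1; ...; dl] = xi dl * ... * xi d1 *)
Definition path_voltage (p : seq (dart X)) : Gam :=
  foldl (fun g d => xi d * g) 1 p.

Definition voltage_premaniplex (n : nat) : Prop :=
  [/\ premaniplex n X,
      exists T : pred (dart X),
        [/\ spanning_tree T, forall d, T d -> xi d = 1
          & generates (fun g => exists d, ~~ T d /\ g = xi d)],
      forall d, semi_edge d -> xi d <> 1 /\ xi d ^+ 2 = 1,
      forall d e, parallel d e -> d <> e -> xi d <> xi e
    & forall (i j : nat) (x y : vertex X) (p : seq (dart X)),
        (i.+1 < j) || (j.+1 < i) -> alternating_path i j x p y ->
        path_voltage p = 1].

Definition derived_dinv (dg : dart X * Gam) : dart X * Gam :=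
  (dinv dg.1, xi dg.1 * dg.2).

Lemma derived_dinvK : involutive derived_dinv.
Proof. by case=> d g; rewrite /derived_dinv /= dinvK volt_dinv mulKg. Qed.

Definition derived : cgraph :=
  {| vertex := vertex X * Gam;
     dart := dart X * Gam;
     init := fun dg => (init dg.1, dg.2);
     dinv := derived_dinv;
     colour := fun dg => colour dg.1;
     dinvK := derived_dinvK;
     colour_dinv := fun dg => colour_dinv dg.1 |}.

End Voltage.

(* Main.v *)
(** A path of [X] from [x] to [y] lifts, at each [g], to a path of the derived
    graph from [(x, g)] to [(y, path_voltage p * g)], and every path of the
    derived graph arises so. Paths avoiding colour [r] have trivial voltage, so
    each sheet of the derived graph over a component of [remove_colour r X] is
    a copy of that component. Hence two flags joined by colours in [[0, m]]
    with [m < r] lie in one sheet, and a second path between them with colours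
    in [[k, r]] projects to a path of voltage 1 with both ends in one
    component; the condition on paths replaces it by one avoiding colour [r],
    and the intersection property of the component applies. The condition is
    conversely the intersection property for [[0, r-1]] and [[m, r]]. *)
Require Import Defs.
From mathcomp Require Import all_boot.
From mathcomp Require Import boolp.

Set Implicit Arguments.
Unset Strict Implicit.
Unset Printing Implicit Defensive.

Local Open Scope group_scope.

(** * Reachability by paths with restricted colours *)

Section Paths.
Variable G : cgraph.
Implicit Types (d : dart G) (x y z : vertex G) (p q : seq (dart G)).
Implicit Types (C D : pred nat).

Lemma term_dinv d : term (dinv d) = init d.
Proof. by rewrite /term dinvK. Qed.

Lemma is_path_cat x y z p q :
  is_path x p y -> is_path y q z -> is_path x (p ++ q) z.
Proof.
by elim: p x => [|d p IHp] x /=; [move=> -> | case=> <- /IHp + /[dup] yz => /(_ yz)].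
Qed.

Lemma joined_using_refl C x : joined_using C x x.
Proof. by exists [::]. Qed.

Lemma joined_using_trans C x y z :
  joined_using C x y -> joined_using C y z -> joined_using C x z.
Proof.
move=> [p [xy Cp]] [q [yz Cq]]; exists (p ++ q); split; first exact: is_path_cat xy yz.
by rewrite /uses_colours all_cat; apply/andP.
Qed.

Lemma joined_using_dart C d : C (colour d) -> joined_using C (init d) (term d).
Proof. by exists [:: d]; rewrite /uses_colours /= andbT. Qed.

Lemma joined_using_sym C x y : joined_using C x y -> joined_using C y x.
Proof.
case=> p [xy Cp]; elim: p x xy Cp => [|d p IHp] x /=.
  by move=> -> _; apply: joined_using_refl.
move=> [<- dy] /andP[Cd Cp]; apply: joined_using_trans (IHp _ dy Cp) _.
by rewrite -(term_dinv d); apply: joined_using_dart; rewrite colour_dinv.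
Qed.

Lemma sub_joined_using C D x y :
  {subset C <= D} -> joined_using C x y -> joined_using D x y.
Proof. by move=> sCD [p [xy /(sub_all (fun d => sCD _)) Dp]]; exists p. Qed.

Lemma joinedE x y : joined x y <-> joined_using predT x y.
Proof.
split=> -[p]; last by case=> xy _; exists p.
by move=> xy; exists p; split=> //; apply: all_predT.
Qed.

End Paths.

(** * Transport of paths along colour-preserving maps and into subgraphs *)

Section Morphism.
Variables (G H : cgraph) (fv : vertex G -> vertex H) (fd : dart G -> dart H).
Hypothesis f_init : forall d, init (fd d) = fv (init d).
Hypothesis f_term : forall d, term (fd d) = fv (term d).
Hypothesis f_colour : forall d, colour (fd d) = colour d.

Lemma is_path_map x p y : is_path x p y -> is_path (fv x) (map fd p) (fv y).
Proof.
elim: p x => [|d p IHp] x /=; first by move=> ->.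
by case=> <- /IHp; rewrite f_init f_term.
Qed.

Lemma uses_colours_map C p : uses_colours C (map fd p) = uses_colours C p.
Proof. by rewrite /uses_colours all_map; apply: eq_all => d /=; rewrite f_colour. Qed.

Lemma alternating_path_map i j x p y :
  alternating_path i j x p y -> alternating_path i j (fv x) (map fd p) (fv y).
Proof.
case=> xy Ep; split; first exact: is_path_map.
by rewrite -Ep -map_comp; apply: eq_map => d /=; rewrite f_colour.
Qed.

End Morphism.

(** Used for two subgraphs: the spanning tree with trivial voltages, and the graph without one
    colour. Backwards, the path is rebuilt dart by dart so that each dart carries its membership
    proof. *)
Lemma joined_using_spanning (G : cgraph) (T : pred (dart G))
    (Tinv : forall d, T d -> T (dinv d)) (C : pred nat) (x y : vertex G) :
  joined_using (G := spanning_subgraph Tinv) C x y <->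
  exists p, [/\ is_path x p y, uses_colours C p & all T p].
Proof.
split=> [[p [xy Cp]] | [p [xy Cp Tp]]].
  exists (map val p); split.
  - exact: (@is_path_map (spanning_subgraph Tinv) G id val).
  - by rewrite (@uses_colours_map (spanning_subgraph Tinv) G val).
  - by elim: (p) => //= -[d Td] q IHq; apply/andP.
elim: p x xy Cp Tp => [|d p IHp] x /=; first by move=> -> _ _; apply: joined_using_refl.
move=> [<- dy] /andP[Cd Cp] /andP[Td Tp].
apply: joined_using_trans (IHp _ dy Cp Tp).
exact: (joined_using_dart (G := spanning_subgraph Tinv) (d := exist _ d Td)).
Qed.

Lemma joined_using_remove_colour (G : cgraph) (r : nat) (C : pred nat) (x y : vertex G) :
  joined_using (G := remove_colour r G) C x y <->
  joined_using (fun c => C c && (c != r)) x y.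
Proof.
rewrite joined_using_spanning /joined_using /uses_colours; split=> -[p].
  by case=> xy Cp Tp; exists p; rewrite all_predI Cp.
by case=> xy; rewrite all_predI => /andP[Cp Tp]; exists p.
Qed.

(** A path that starts in a component never leaves it, so restricting to the component loses no
    path. *)
Lemma joined_using_component (G : cgraph) (x0 : vertex G) (C : pred nat)
    (x y : vertex (component x0)) :
  joined_using C x y <-> joined_using C (val x) (val y).
Proof.
split=> -[p [xy Cp]].
  exists (map val p); split; first exact: (@is_path_map (component x0) G val val).
  by rewrite (@uses_colours_map (component x0) G val).
elim: p x xy Cp => [|d p IHp] x /=.
  by move=> /val_inj -> _; apply: joined_using_refl.
move=> [dx dy] /andP[Cd Cp].
have x0d : `[< joined x0 (init d) >] by rewrite dx; apply: (valP x).
pose d' : dart (component x0) := exist _ d x0d.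
have -> : x = init d' by apply: val_inj.
apply: joined_using_trans (IHp (term d') dy Cp).
exact: joined_using_dart.
Qed.

(** * Path lifting to the derived graph *)

Section Derived.
Variables (X : cgraph) (Gam : groupType) (xi : voltage X Gam).
Implicit Types (x y : vertex X) (p : seq (dart X)) (g h : Gam).

Lemma path_voltage_cons d p :
  path_voltage xi (d :: p) = path_voltage xi p * xi d.
Proof.
rewrite /path_voltage /= mulg1 -[in LHS](mul1g (xi d)).
(* The induction needs an arbitrary accumulator in place of [1]. *)
by elim: p (1) => //= e p IHp g; rewrite mulgA IHp.
Qed.

Lemma path_voltage_eq1 (P : pred (dart X)) p :
  (forall d, P d -> xi d = 1) -> all P p -> path_voltage xi p = 1.
Proof.
move=> xiP; elim: p => //= d p IHp /andP[Pd /IHp xip].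
by rewrite path_voltage_cons xip xiP // mulg1.
Qed.

Lemma is_path_derived (u v : vertex (derived xi)) q :
  is_path u q v ->
  is_path u.1 (map fst q) v.1 /\ v.2 = path_voltage xi (map fst q) * u.2.
Proof.
split; first exact: (@is_path_map (derived xi) X fst fst).
elim: q u H => [|d q IHq] u /=; first by move=> ->; rewrite mul1g.
by case=> <- /IHq ->; rewrite path_voltage_cons -mulgA.
Qed.

Lemma joined_using_derived (C : pred nat) (u v : vertex (derived xi)) :
  joined_using C u v <->
  exists p, [/\ is_path u.1 p v.1, uses_colours C p
              & v.2 = path_voltage xi p * u.2].
Proof.
split=> [[q [/is_path_derived[uv Ev] Cq]] | [p []]].
  by exists (map fst q); rewrite (@uses_colours_map (derived xi) X fst).
case: u v => [x g] [y h] /=; elim: p x g => [|d p IHp] x g /=.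
  by move=> -> _ ->; rewrite mul1g; apply: joined_using_refl.
move=> [<- dy] /andP[Cd Cp] Eh.
apply: (@joined_using_trans _ _ _ ((term d, xi d * g) : vertex (derived xi))).
  exact: (joined_using_dart (G := derived xi) (d := (d, g))).
by apply: IHp => //; rewrite Eh path_voltage_cons mulgA.
Qed.

(** A loop [d] and [dinv d] start at the same vertex with the same colour, and the dart with these
    data is unique. *)
Lemma premaniplex_loop n (d : dart X) :
  premaniplex n X -> init d = term d -> semi_edge d.
Proof.
case=> _ /(_ d) dn /(_ (init d) _ dn)[e [_ e_uniq]] _ Ed.
by apply: etrans (e_uniq d _); rewrite // -(e_uniq (dinv d)) // colour_dinv.
Qed.

(** * Connectedness and simplicity of the derived graph *)

Section VoltagePremaniplex.
Variable n : nat.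
Hypothesis hX : voltage_premaniplex xi n.

Lemma voltage_loop_neq1 d : init d = term d -> xi d <> 1.
Proof. by case: hX => hp _ hs _ _ /(premaniplex_loop hp) /hs[]. Qed.

Lemma voltage_parallel_inj d e : parallel d e -> xi d = xi e -> d = e.
Proof. by case: hX => _ _ _ hpar _ /hpar pde Exi; apply: contrapT => /pde. Qed.

Lemma derived_connected : connected (derived xi).
Proof.
case: hX => -[[[x0] _] _ _ _] [T [[Tinv [[_ Tconn] _]] xiT genT]] _ _ _.
split; first exact: (inhabits ((x0, 1) : vertex (derived xi))).
(* Moving along the tree changes the vertex but keeps the sheet. *)
have treeP x y g : joined_using (G := derived xi) predT (x, g) (y, g).
  have /joinedE/joined_using_spanning[p [xy Cp Tp]] := Tconn x y.
  by apply/joined_using_derived; exists p; rewrite (path_voltage_eq1 xiT Tp) mul1g.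
suff transl g x h : joined_using (G := derived xi) predT (x, h) (x, g * h).
  move=> [x g] [y h]; apply/joinedE; apply: joined_using_trans (treeP x y g) _.
  by rewrite -(mulgVK g h).
move: g x h.
(* The [g] by which every fibre can be translated form a subgroup. It contains [xi d] for each dart
   [d] outside the tree: follow the tree to [init d], cross [d], and return along the tree. *)
apply: (genT (fun g => forall x h, joined_using (G := derived xi) predT (x, h) (x, g * h))).
- by move=> x h; rewrite mul1g; apply: joined_using_refl.
- by move=> g1 g2 H1 H2 x h; rewrite -mulgA; apply: joined_using_trans (H2 x h) _.
- move=> g Hg x h; apply: joined_using_sym.
  by have := Hg x (g^-1 * h); rewrite mulVKg.
- move=> _ [d [_ ->]] x h; apply: joined_using_trans (treeP x (init d) h) _.
  apply: joined_using_trans (treeP (term d) x (xi d * h)).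
  exact: (joined_using_dart (G := derived xi) (d := (d, h))).
Qed.

(** A loop at [(d, g)] would make [d] a loop of voltage 1, and two distinct parallel darts would
    project to distinct parallel darts of equal voltage. Alternating paths close up because their
    projections are closed with trivial voltage. *)
Lemma derived_maniplex : maniplex n (derived xi).
Proof.
case: (hX) => -[_ hcol huniq halt] _ _ _ haltv; split; [split|split].
- exact: derived_connected.
- by case=> d g; apply: hcol.
- move=> [x g] i /(huniq x)[d [[dx di] d_uniq]]; exists (d, g); split.
    by rewrite /= dx di.
  by move=> [e h] [[ex <-] ei]; rewrite (d_uniq e).
- move=> i j [x g] [y h] q ij aq.
  have ap : alternating_path i j x (map fst q) y.
    exact: (@alternating_path_map (derived xi) X fst fst _ _ _ i j (x, g) q (y, h)).
  have [/is_path_derived[_ /= ->] _] := aq.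
  by rewrite (haltv _ _ _ _ _ ij ap) mul1g (halt _ _ _ _ _ ij ap).
- move=> [d g] [/voltage_loop_neq1 xid /esym Eg]; apply: xid.
  by apply: (mulIg g); rewrite mul1g.
- move=> [d g] [e h] [[Ei Eg] [Et Ex]]; subst h.
  by rewrite (voltage_parallel_inj (conj Ei Et) (mulIg _ _ _ Ex)).
Qed.

End VoltagePremaniplex.

(** [X] itself may have semi-edges and parallel darts, but their voltages are nontrivial or distinct
    respectively. Darts of the component all have voltage 1, which excludes both. *)
Lemma component_maniplex r (x0 : vertex X) :
  voltage_premaniplex xi r.+1 -> (forall d, colour d < r -> xi d = 1) ->
  maniplex r (component (G := remove_colour r X) x0).
Proof.
move=> hX hxi; case: (hX) => -[_ hcol huniq halt] _ _ _ _.
set K := component _.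
have colK (d : dart K) : colour d < r.
  case: d => -[d dr] x0d /=; have := hcol d.
  by rewrite ltnS leq_eqVlt (negPf dr).
have xiK (d : dart K) : xi (val (val d)) = 1 by apply/hxi/(colK d).
split; [split|split] => //.
- split; first by apply: inhabits; exists x0; apply/asboolP; exists [::].
  move=> [x x0x] [y x0y]; apply/joinedE/joined_using_component => /=.
  apply: (@joined_using_trans (remove_colour r X) predT x x0 y).
    by apply/joined_using_sym/joinedE/asboolP.
  exact/joinedE/asboolP.
- move=> x i ir; have [d [[dx di] d_uniq]] := huniq (val x) i (ltnW ir).
  have dr : colour d != r by rewrite di neq_ltn ir.
  have x0d : `[< joined (G := remove_colour r X) x0 (init d) >].
    by rewrite dx; apply: (valP x).
  exists (exist _ (exist _ d dr) x0d); split.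
    by split=> //; apply: val_inj.
  move=> e [ex ei]; do 2 apply: val_inj; apply: d_uniq; split=> //.
  by rewrite -ex.
- move=> i j x y p ij ap; apply: val_inj.
  apply: (halt i j _ _ (map (fun d => val (val d)) p)) => //.
  exact: (@alternating_path_map K X val (fun d => val (val d))).
- move=> d Ed; apply: (voltage_loop_neq1 hX _ (xiK d)).
  exact: (congr1 val Ed).
- move=> d e [Ei Et]; do 2 apply: val_inj.
  apply: (voltage_parallel_inj hX); last by rewrite !xiK.
  by split; [apply: (congr1 val Ei) | apply: (congr1 val Et)].
Qed.

End Derived.

(** * Polytopality of the derived graph against the component and path conditions *)

Theorem theorem9p2 (r : nat) (X : cgraph) (Gam : groupType) (xi : voltage X Gam)
  (hX : voltage_premaniplex xi r.+1)
  (hxi : forall d : dart X, colour d < r -> xi d = 1%g) :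
  polytope r.+1 (derived xi) <->
  (forall x : vertex (remove_colour r X),
     polytope r (component x)) /\
  (forall m : nat, m <= r ->
     forall (x y : vertex X) (W : seq (dart X)),
       is_path x W y ->
       path_voltage xi W = 1%g ->
       uses_colours (fun c => m <= c <= r) W ->
       joined (G := remove_colour r X) x y ->
       exists W' : seq (dart X),
         is_path x W' y /\ uses_colours (fun c => m <= c < r) W').
Proof.
have colX (d : dart X) : colour d <= r by case: hX => -[_ /(_ d)].
have path1 (C : pred nat) p : (forall c, C c -> c < r) ->
    uses_colours C p -> path_voltage xi p = 1.
  by move=> Cr; apply: path_voltage_eq1 => d /Cr; apply: hxi.
have lift (C : pred nat) x y g : (forall c, C c -> c < r) ->
    joined_using C x y -> joined_using (G := derived xi) C (x, g) (y, g).
  move=> Cr [p [xy Cp]]; apply/joined_using_derived; exists p.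
  by rewrite (path1 C) // mul1g.
have joined_removed (x y : vertex X) :
    joined (G := remove_colour r X) x y -> joined_using (G := X) (fun c => c < r) x y.
  move=> /joinedE/joined_using_remove_colour[p [xy Cp]]; exists p; split=> //.
  by apply: sub_all Cp => d /= dr; rewrite ltn_neqAle dr colX.
split=> [[_ hP] | [hK hW]].
  split=> [x0 | m mr x y W xy xiW CW xyK].
    split; first exact: component_maniplex hX hxi.
    move=> k m x y kr mr /joined_using_component/joined_using_remove_colour xym.
    move=> /joined_using_component/joined_using_remove_colour xyk.
    apply/joined_using_component/joined_using_remove_colour.
    (* Both paths are lifted to the sheet of [1]. The path obtained there is projected back, and its
       colours, at most [m < r], keep it off colour [r]. *)
    have := hP k m (val x, 1) (val y, 1) (ltnW kr) (ltnW mr).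
    case.
    - apply: lift => [c cm|]; first exact: leq_ltn_trans cm mr.
      by apply: sub_joined_using xym => c /andP[].
    - apply: (@sub_joined_using _ (fun c => k <= c < r)).
        by move=> c /andP[kc /ltnW cr]; apply/andP.
      by apply: lift => [c /andP[]|] //; apply: sub_joined_using xyk => c /andP[].
    - move=> q [/is_path_derived[xy _] Cq]; exists (map fst q); split=> //.
      rewrite (@uses_colours_map (derived xi) X fst) //.
      apply: sub_all Cq => d /= /andP[-> dm].
      by rewrite dm neq_ltn (leq_ltn_trans dm mr).
  have {}xyK := joined_removed _ _ xyK.
  (* For [r = 0] the bound [r.-1] would still allow colour 0; but then no dart has a colour below
     [r], so [x = y] and the empty path serves. *)
  case: (posnP r) => [r0 | r_gt0].
    case: xyK => -[|d p] [xyp Cp]; first by exists [::].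
    by move: Cp; rewrite /= r0.
  have r1 c : (c <= r.-1) = (c < r) by rewrite -ltnS prednK.
  have := hP m r.-1 (x, 1) (y, 1) mr (leq_pred r).
  case; last first.
  - move=> q [/is_path_derived[xyq _] Cq]; exists (map fst q); split=> //.
    rewrite (@uses_colours_map (derived xi) X fst) //.
    by apply: sub_all Cq => d /=; rewrite r1.
  - by apply/joined_using_derived; exists W; rewrite xiW mul1g.
  - apply: lift => [c|]; first by rewrite r1.
    by apply: sub_joined_using xyK => c; rewrite /in_mem /= r1.
split; first exact: derived_maniplex hX.
move=> k m [x g] [y h]; rewrite !ltnS => kr.
(* For [m = r] the second path is already the required one. *)
rewrite leq_eqVlt => /predU1P[-> _ //| mr].
move=> /joined_using_derived[p /= [xyp Cp Eh]].
rewrite (path1 (fun c => c <= m)) ?mul1g // in Eh; last first.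
  by move=> c cm; apply: leq_ltn_trans cm mr.
subst h => /joined_using_derived[W /= [xyW CW Eg]].
have xyK : joined_using (G := remove_colour r X) (fun c => c <= m) x y.
  apply/joined_using_remove_colour; exists p; split=> //.
  by apply: sub_all Cp => d /= dm; rewrite dm neq_ltn (leq_ltn_trans dm mr).
have xyK' : joined (G := remove_colour r X) x y.
  by apply/joinedE; apply: sub_joined_using xyK.
(* The first path has trivial voltage, so both flags lie in the sheet of [g] and the voltage of [W]
   fixes [g]. *)
have xiW : path_voltage xi W = 1 by apply: (mulIg g); rewrite -Eg mul1g.
have [W' [xyW' CW']] := hW k kr x y W xyW xiW CW xyK'.
apply: lift => [c /andP[_ cm]|]; first exact: leq_ltn_trans cm mr.
(* The component has rank [r], so its intersection property needs [k < r]. For [k = r] no colour is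
   available to [W'], which is therefore empty. *)
case: (ltnP k r) => [{}kr | rk]; last first.
  case: W' xyW' CW' => [-> _|d W' _]; first exact: joined_using_refl.
  by move=> /andP[/andP[kd]]; rewrite ltnNge (leq_trans rk kd).
have [_ hP] := hK x.
have xx : `[< joined (G := remove_colour r X) x x >] by apply/asboolP; exists [::].
have xy : `[< joined (G := remove_colour r X) x y >] by apply/asboolP.
pose x' : vertex (component (G := remove_colour r X) x) := exist _ x xx.
pose y' : vertex (component (G := remove_colour r X) x) := exist _ y xy.
suff /joined_using_component/joined_using_remove_colour :
    joined_using (fun c => k <= c <= m) x' y'.
  by apply: sub_joined_using => c /andP[].
apply: hP => //; first exact/joined_using_component.
apply/joined_using_component/joined_using_remove_colour; exists W'; split=> //.
by apply: sub_all CW' => d /= /andP[-> dr]; rewrite dr neq_ltn dr.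
Qed.
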